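(* Let $\Gamma$ be a set and $\{X_\gamma:\gamma\in\Gamma\}$ a family of Banach spaces indexed by $\Gamma$. Then $Z:=\bigoplus_{\gamma\in\Gamma}^{c_0}X_\gamma$ has property $\mathrm{(P1)}$ (respectively $(\overline{\mathrm{P1}})$) if and only if $X_\gamma$ has property $\mathrm{(P1)}$ (respectively $(\overline{\mathrm{P1}})$) for every $\gamma\in\Gamma$.
   Context: Banach spaces are real or complex. For a Banach space $X$, $B_X$ is the closed unit ball. For $f\in B_{X^*}$ and $\varepsilon>0$, the slice of $B_X$ is $S(B_X,f,\varepsilon)=\{x\in B_X:\ \mathrm{Re}\, f(x)>\sup_{c\in B_X}|f(c)|-\varepsilon\}$. A convex combination of slices of $B_X$ is a set $\sum_{i=1}^n\lambda_i S_i=\{\sum_{i=1}^n \lambda_i x_i: x_i\in S_i\}$ with $n\in\mathbb{N}$, $\lambda_i>0$, $\sum_{i=1}^n\lambda_i=1$ and each $S_i$ a slice of $B_X$. $X$ has property $\mathrm{(P1)}$ (respectively $(\overline{\mathrm{P1}})$) if for every convex combination of slices $C$ of $B_X$ and every $x\in C$ there exists a relatively weakly open subset $W$ of $B_X$ with $x\in W\subseteq C$ (respectively $x\in W\subseteq\overline{C}$, norm closure). The $c_0$-sum $\bigoplus_{\gamma\in\Gamma}^{c_0}X_\gamma$ consists of all $(x_\gamma)$, $x_\gamma\in X_\gamma$, such that $\{\gamma:\|x_\gamma\|\ge\eta\}$ is finite for every $\eta>0$, with norm $\|(x_\gamma)\|=\sup_\gamma\|x_\gamma\|$. *)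

(* Defs.v *)
From HB Require Import structures.
From mathcomp Require Import all_boot all_order all_algebra.
From mathcomp Require Import all_classical all_reals all_analysis.
From mathcomp Require Import complex.

Set Implicit Arguments.
Unset Strict Implicit.
Unset Printing Implicit Defensive.

Import Order.TTheory GRing.Theory Num.Theory.
Import numFieldNormedType.Exports.

Local Open Scope classical_set_scope.
Local Open Scope ring_scope.

(* Everything is developed over a numFieldType K; it is meant to be used with
   K := R and K := R[i] for R : realType. In R[i] the order is partial: x <= y
   means that y - x is a nonnegative real, so that 0 < e says that e is a
   positive real, and norms take their values in K. *)

Section Slices.
Variables (K : numFieldType) (X : normedModType K).

Definition unit_ball : set X := [set x | `|x| <= 1].

Record dual := Dual {
  dual_fun :> {linear X -> K^o};
  dual_continuous : continuous dual_fun }.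

(* [supremum 0 A] is the least upper bound of A in the order of K when there is
   one; for a continuous functional over R or R[i] there always is one. *)
Definition dual_norm (f : dual) : K :=
  supremum 0 [set `|f c| | c in unit_ball].

Definition weak_topology : Type :=
  sup_topology (fun f : dual => Topological.on (initial_topology f)).

HB.instance Definition _ := Topological.on weak_topology.

Definition weakly_open (U : set X) : Prop := open (U : set weak_topology).

Definition rel_weakly_open (W : set X) : Prop :=
  exists U : set X, weakly_open U /\ W = U `&` unit_ball.

(* The real part map is a parameter: idfun for K := R, 'Re for K := R[i]. *)
Variable re : K -> K.

Definition slice (f : dual) (e : K) : set X :=
  [set x | unit_ball x /\ dual_norm f - e < re (f x)].

Definition is_slice (S : set X) : Prop :=
  exists (f : dual) (e : K), [/\ dual_norm f <= 1, 0 < e & S = slice f e].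

Definition is_convex_comb_slices (C : set X) : Prop :=
  exists (n : nat) (l : 'I_n -> K) (S : 'I_n -> set X),
    [/\ forall i, 0 < l i, \sum_(i < n) l i = 1, forall i, is_slice (S i) &
        C = [set \sum_(i < n) l i *: x i |
              x in [set x : 'I_n -> X | forall i, S i (x i)]]].

Definition property_P1 : Prop :=
  forall C, is_convex_comb_slices C -> forall x, C x ->
  exists W, [/\ rel_weakly_open W, W x & W `<=` C].

Definition property_P1_closure : Prop :=
  forall C, is_convex_comb_slices C -> forall x, C x ->
  exists W, [/\ rel_weakly_open W, W x & W `<=` closure C].

End Slices.

Section C0Sum.
Variables (K : numFieldType) (I : Type) (X : I -> completeNormedModType K).

Definition c0_family (x : forall i, X i) : Prop :=
  forall e : K, 0 < e -> finite_set [set i | e <= `|x i|].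

Record c0sum := C0sum {
  c0fun :> forall i, X i;
  c0funP : c0_family c0fun }.

Lemma c0sumP (x y : c0sum) : (forall i, x i = y i) -> x = y.
Proof.
case: x y => [x xP] [y yP] /= xy.
have {xy} exy : x = y by exact: functional_extensionality_dep.
by subst y; congr C0sum; exact: Prop_irrelevance.
Qed.

HB.instance Definition _ := gen_eqMixin c0sum.
HB.instance Definition _ := gen_choiceMixin c0sum.

Lemma c0_family0 : c0_family (fun=> 0).
Proof.
move=> e e0; rewrite (_ : [set _ | _] = set0)//.
by rewrite -subset0 => i /=; rewrite normr0 => /(lt_le_trans e0); rewrite ltxx.
Qed.

Lemma c0_familyN (x : c0sum) : c0_family (fun i => - x i).
Proof.
move=> e /(c0funP x); apply: sub_finite_set => i /=.
by rewrite normrN.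
Qed.

Lemma c0_familyD (x y : c0sum) : c0_family (fun i => x i + y i).
Proof.
move=> e e0; have e20 : 0 < e / 2 by rewrite divr_gt0.
have : finite_set ([set i | e / 2 <= `|x i|] `|` [set i | e / 2 <= `|y i|]).
  by rewrite finite_setU; split; exact: c0funP.
apply: sub_finite_set => i /= exy.
have real_e2 : e / 2 \is Num.real by exact: gtr0_real.
case: (real_leP real_e2 (normr_real (x i))) => [|xe]; first by left.
case: (real_leP real_e2 (normr_real (y i))) => [|ye]; first by right.
have := le_lt_trans (ler_normD (x i) (y i)) (ltrD xe ye).
by rewrite -splitr => /(le_lt_trans exy); rewrite ltxx.
Qed.

Lemma c0_familyZ (a : K) (x : c0sum) : c0_family (fun i => a *: x i).
Proof.
have [->|a0] := eqVneq a 0.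
  move=> e /c0_family0; apply: sub_finite_set => i /=.
  by rewrite scale0r.
have na0 : 0 < `|a| by rewrite normr_gt0.
move=> e e0; have /(c0funP x) : 0 < e / `|a| by rewrite divr_gt0.
by apply: sub_finite_set => i /=; rewrite normrZ ler_pdivrMr// mulrC.
Qed.

Definition c0zero := C0sum c0_family0.
Definition c0opp x := C0sum (c0_familyN x).
Definition c0add x y := C0sum (c0_familyD x y).
Definition c0scale a x := C0sum (c0_familyZ a x).

Lemma c0addA : associative c0add.
Proof. by move=> x y z; apply: c0sumP => i /=; rewrite addrA. Qed.

Lemma c0addC : commutative c0add.
Proof. by move=> x y; apply: c0sumP => i /=; rewrite addrC. Qed.

Lemma c0add0 : left_id c0zero c0add.
Proof. by move=> x; apply: c0sumP => i /=; rewrite add0r. Qed.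

Lemma c0addN : left_inverse c0zero c0opp c0add.
Proof. by move=> x; apply: c0sumP => i /=; rewrite addNr. Qed.

HB.instance Definition _ :=
  GRing.isZmodule.Build c0sum c0addA c0addC c0add0 c0addN.

Lemma c0scaleA a b x : c0scale a (c0scale b x) = c0scale (a * b) x.
Proof. by apply: c0sumP => i /=; rewrite scalerA. Qed.

Lemma c0scale1 : left_id 1 c0scale.
Proof. by move=> x; apply: c0sumP => i /=; rewrite scale1r. Qed.

Lemma c0scaleDr : right_distributive c0scale +%R.
Proof. by move=> a x y; apply: c0sumP => i /=; rewrite scalerDr. Qed.

Lemma c0scaleDl x : {morph c0scale^~ x : a b / a + b}.
Proof. by move=> a b; apply: c0sumP => i /=; rewrite scalerDl. Qed.

HB.instance Definition _ := GRing.Zmodule_isLmodule.Build K c0sum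
  c0scaleA c0scale1 c0scaleDr c0scaleDl.

(* The default value 0 only matters when I is empty: otherwise the supremum is
   attained, see c0norm_max. *)
Definition c0norm (x : c0sum) : K := supremum 0 (range (fun i => `|x i|)).

Lemma seq_norm_max (s : seq K) : s != [::] -> {in s, forall a, a \is Num.real} ->
  exists2 m, m \in s & {in s, forall a, a <= m}.
Proof.
elim: s => // a [|b s] IHs _ sR.
  by exists a => [|c]; rewrite ?inE// => /eqP ->.
have [//|c cs|m ms mub] := IHs; first by apply: sR; rewrite inE cs orbT.
have aR : a \is Num.real by apply: sR; rewrite inE eqxx.
have mR : m \is Num.real by apply: sR; rewrite inE ms orbT.
case: (real_leP aR mR) => [am|/ltW ma].
  exists m => [|c]; first by rewrite inE ms orbT.
  by rewrite inE => /orP[/eqP->//|/mub].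
exists a => [|c]; first by rewrite inE eqxx.
by rewrite inE => /orP[/eqP->//|/mub /le_trans]; exact.
Qed.

Lemma c0norm_max (x : c0sum) (i0 : I) :
  exists i1, c0norm x = `|x i1| /\ forall i, `|x i| <= `|x i1|.
Proof.
suff [i1 i1P] : exists i1, forall i, `|x i| <= `|x i1|.
  exists i1; split => //; rewrite /c0norm /supremum ifF; last first.
    by apply/negbTE/set0P; exists `|x i1|; exists i1.
  apply: (@is_subset1_supremums _ _ (range (fun i => `|x i|))).
    apply: xgetPex; exists `|x i1|; split => [_ [i _ <-]//|y]; apply.
    by exists i1.
  by split => [_ [i _ <-]//|y]; apply; exists i1.
case: (pselect (exists i, x i != 0)) => [[i xi0]|x0]; last first.
  exists i0 => i; have [->|xi0] := eqVneq (x i) 0; first by rewrite normr0.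
  by exfalso; apply: x0; exists i.
have /(c0funP x) /(finite_image (fun i => `|x i|)) /finite_seqP[s sE] :
  0 < `|x i| by rewrite normr_gt0.
have sP a : (exists2 j, `|x i| <= `|x j| & `|x j| = a) <-> a \in s.
  by rewrite -[X in _ <-> X]/([set` s] a) -sE.
have xis : `|x i| \in s by apply/sP; exists i.
have [|a|m /sP[j _ <-] mub] := @seq_norm_max s.
- by apply: contraTneq xis => ->.
- by move=> /sP[j _ <-].
exists j => k.
case: (real_leP (normr_real (x i)) (normr_real (x k))) => [ik|/ltW ki].
  by apply: mub; apply/sP; exists k.
by rewrite (le_trans ki)// mub.
Qed.

Lemma c0norm_empty (x : c0sum) : ~ (exists i : I, True) -> c0norm x = 0.
Proof.
move=> I0; rewrite /c0norm; set A := (X in supremum _ X).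
suff -> : A = set0 by rewrite supremum0.
by rewrite -subset0 => a [i _ _]; case: I0; exists i.
Qed.

Lemma c0norm_ge (x : c0sum) i : `|x i| <= c0norm x.
Proof. by have [j [-> jP]] := c0norm_max x i. Qed.

Lemma c0norm_le (x : c0sum) (M : K) :
  0 <= M -> (forall i, `|x i| <= M) -> c0norm x <= M.
Proof.
move=> M0 xM; case: (pselect (exists i : I, True)) => [[i _]|I0].
  by have [j [-> _]] := c0norm_max x i.
by rewrite c0norm_empty.
Qed.

Lemma c0norm_ge0 (x : c0sum) : 0 <= c0norm x.
Proof.
case: (pselect (exists i : I, True)) => [[i _]|I0].
  exact: le_trans (c0norm_ge x i).
by rewrite c0norm_empty.
Qed.

Lemma ler_c0normD (x y : c0sum) : c0norm (x + y) <= c0norm x + c0norm y.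
Proof.
apply: c0norm_le => [|i]; first by rewrite addr_ge0 ?c0norm_ge0.
by rewrite (le_trans (ler_normD _ _))// lerD ?c0norm_ge.
Qed.

Lemma c0normZ (a : K) (x : c0sum) : c0norm (a *: x) = `|a| * c0norm x.
Proof.
have leZ b y : c0norm (b *: y) <= `|b| * c0norm y.
  apply: c0norm_le => [|i]; first by rewrite mulr_ge0 ?c0norm_ge0.
  by rewrite [X in `|X|]/(b *: y i) normrZ ler_wpM2l ?c0norm_ge.
apply/eqP; rewrite eq_le leZ/=.
have [->|a0] := eqVneq a 0; first by rewrite normr0 mul0r c0norm_ge0.
have := leZ a^-1 (a *: x).
by rewrite scalerA mulVf// scale1r normfV ler_pdivlMl ?normr_gt0.
Qed.

Lemma c0norm0_eq0 (x : c0sum) : c0norm x = 0 -> x = 0.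
Proof.
move=> x0; apply: c0sumP => i.
by apply/eqP; rewrite -normr_le0 -x0 c0norm_ge.
Qed.

HB.instance Definition _ := Lmodule_isNormed.Build K c0sum
  ler_c0normD c0normZ c0norm0_eq0.

Lemma c0norm_coord (x y : c0sum) i : `|x i - y i| <= `|x - y|.
Proof. exact: (c0norm_ge (x - y) i). Qed.

Lemma c0sum_complete (F : set_system c0sum) :
  ProperFilter F -> cauchy F -> cvg F.
Proof.
move=> FF /cauchyP Fc.
have Fi i : cvg ((fun x : c0sum => x i) @ F).
  apply: cauchy_cvg; apply: cauchy_exP => e e0.
  have [x xF] := Fc e e0; exists (x i).
  change (F [set y : c0sum | ball (x i) e (y i)]); apply: filterS xF => y.
  by rewrite -!ball_normE /=; apply: le_lt_trans; exact: c0norm_coord.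
pose l i : X i := lim ((fun x : c0sum => x i) @ F).
have lP (y : c0sum) (e : K) : 0 < e -> F (ball y e) ->
    forall i, `|y i - l i| <= e + e.
  move=> e0 yF i.
  have Fl : F [set x : c0sum | ball (l i) e (x i)].
    exact: (Fi i _ (nbhsx_ballx (l i) e e0)).
  have [x [/= yx lx]] := filter_ex (filterI yF Fl).
  rewrite -ball_normE /= distrC in lx; rewrite -ball_normE /= in yx.
  rewrite (le_trans (ler_distD (x i) _ _))// lerD// ltW//.
  exact: le_lt_trans (c0norm_coord y x i) yx.
have lc0 : c0_family l.
  move=> e e0; have e4 : 0 < e / 2 / 2 by rewrite !divr_gt0.
  have [y yF] := Fc _ e4.
  have /(c0funP y) : 0 < e / 2 by rewrite divr_gt0.
  apply: sub_finite_set => i /= eli; have := lP y _ e4 yF i.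
  rewrite -splitr distrC => yl.
  rewrite -(lerD2l (e / 2)) -splitr (le_trans eli)//.
  by rewrite -[X in `|X|](subrK (y i)) (le_trans (ler_normD _ _))// lerD.
apply/cvg_ex; exists (C0sum lc0); apply/cvgrPdist_le => /= e e0.
have e4 : 0 < e / 2 / 2 by rewrite !divr_gt0.
have [y yF] := Fc _ e4.
apply: filterS (yF) => x; rewrite -ball_normE /= => yx.
rewrite (le_trans (ler_distD y _ _))// [leRHS]splitr lerD//.
  rewrite distrC; apply: c0norm_le => [|i]; first by rewrite ltW// divr_gt0.
  by rewrite [X in _ <= X]splitr; apply: lP => //.
by rewrite (le_trans (ltW yx))// ler_pdivrMr// ler_peMr// ?ler1n// ltW// divr_gt0.
Qed.

HB.instance Definition _ := Uniform_isComplete.Build c0sum c0sum_complete.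

End C0Sum.

(* Main.v *)
(* A functional F on the c_0-sum is almost determined by finitely many
   coordinates: if u, supported on a finite set s, almost norms F and z in the
   unit ball vanishes on s, then u - z is in the unit ball, so Re F(z) is not much
   below 0. Hence the conditions defining a convex combination C of slices near a
   point z of C follow from similar slice conditions on finitely many
   coordinates, which yield convex combinations D_i of slices in the X_i with
   z_i in D_i; the weak neighbourhoods of the z_i inside the D_i pull back to one
   of z inside C. Conversely, slices of X_i pull back along the projection to
   slices of the sum, and weak neighbourhoods restrict along the isometric
   inclusion of X_i. *)

Require Import Defs.
From HB Require Import structures.
From mathcomp Require Import all_boot all_order all_algebra.
From mathcomp Require Import all_classical all_reals all_analysis.
From mathcomp Require Import complex ring.

Set Implicit Arguments.
Unset Strict Implicit.
Unset Printing Implicit Defensive.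

Import Order.TTheory GRing.Theory Num.Theory.
Import numFieldNormedType.Exports.

Local Open Scope classical_set_scope.
Local Open Scope ring_scope.

(** * Weak continuity, and pulling weakly open sets back along operators *)

Section WeakTopology.
Variables (K : numFieldType) (X Y : normedModType K).

Lemma dual_comp_continuous (f : dual Y) (T : {linear X -> Y}) :
  continuous T -> continuous (f \o T : X -> K^o).
Proof.
by move=> Tc x; apply: continuous_comp; [exact: Tc|exact: dual_continuous].
Qed.

Definition dual_comp (f : dual Y) (T : {linear X -> Y}) (Tc : continuous T) :
  dual X := @Dual K X (f \o T) (@dual_comp_continuous f T Tc).

Lemma weak_dual_continuous (f : dual X) :
  continuous (f : weak_topology X -> K^o).
Proof.
move=> x; apply: cvg_trans (@initial_continuous _ _ f x).
apply: cvg_app.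
have FF : Filter (nbhs (x : weak_topology X)).
  exact: (@nbhs_filter (weak_topology X)).
have := (@cvg_sup X (dual X)
  (fun f : dual X => Topological.on (initial_topology f)) _ x FF).1 _ f.
by apply; exact: cvg_id.
Qed.

(** Convergence in a supremum topology is tested on each functional [f] of [Y], and [f \o T] is a
    functional of [X]. *)
Lemma weakly_open_preimage (T : {linear X -> Y}) (U : set Y) :
  continuous T -> weakly_open U -> weakly_open (T @^-1` U).
Proof.
move=> Tc; suff : continuous (T : weak_topology X -> weak_topology Y).
  by move=> /continuousP; exact.
move=> x.
have FF := fmap_filter T (nbhs_filter (x : weak_topology X)).
apply/(@cvg_sup _ _ _ _ _ FF) => f A [_ [[B oB <-] /= BTx] BA].
have : nbhs (x : weak_topology X) ((dual_comp f Tc) @^-1` B).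
  by apply: weak_dual_continuous; exact: open_nbhs_nbhs.
by apply: filterS => y By; exact: BA.
Qed.

Lemma nonexpansive_continuous (T : {linear X -> Y}) :
  (forall x, `|T x| <= `|x|) -> continuous T.
Proof.
move=> T1; apply: continuousfor0_continuous.
rewrite /prop_for /continuous_at linear0.
apply/cvgrPdist_lt => e e0; apply/nbhs_norm0P; exists e => //= x.
by rewrite sub0r normrN; exact: le_lt_trans.
Qed.

Lemma weakly_open_bigcap (I : choiceType) (s : seq I) (U : I -> set X) :
  (forall i, i \in s -> weakly_open (U i)) ->
  weakly_open (\bigcap_(i in [set` s]) U i).
Proof.
move=> sU; rewrite bigcap_seq big_seq /weakly_open.
by elim/big_ind : _ => //; [exact: openT|move=> A B; exact: openI].
Qed.

Lemma dual_small_near0 (f : dual X) (e : K) : 0 < e ->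
  exists2 d : K, 0 < d & forall x, `|x| <= d -> `|f x| <= e.
Proof.
move=> e0; have f0 : f x @[x --> (0 : X)] --> f 0 by exact: dual_continuous.
move: f0; rewrite linear0 => /cvgrPdist_le /(_ e e0).
(* Halving [d] passes from the open ball to the closed one. *)
move=> /nbhs_norm0P[d /= d0 dP]; exists (d / 2); first by rewrite divr_gt0.
move=> x xd; have := dP x; rewrite sub0r normrN; apply.
by rewrite /= (le_lt_trans xd)// ltr_pdivrMr// ltr_pMr// ltr1n.
Qed.

End WeakTopology.

(** * Inclusions, projections and finite truncations *)

Section Coordinates.
Variables (K : numFieldType) (I : Type) (X : I -> completeNormedModType K).

(** The value [a] lives in [X i], so it has to be transported along a proof of [i = j]. *)
Definition single (i : I) (a : X i) (j : I) : X j :=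
  if pselect (i = j) is left e then eq_rect i X a j e else 0.

Lemma single_id i a : @single i a i = a.
Proof.
rewrite /single; case: pselect => // e.
by rewrite (Prop_irrelevance e erefl).
Qed.

Lemma single_neq i a j : i <> j -> @single i a j = 0.
Proof. by rewrite /single; case: pselect. Qed.

Lemma single_c0 i a : c0_family (@single i a).
Proof.
move=> e e0; apply: (@sub_finite_set _ _ [set i]); last exact: finite_set1.
move=> j /= ej; apply: contrapT => /nesym ij; move: ej.
by rewrite single_neq// normr0 => /(lt_le_trans e0); rewrite ltxx.
Qed.

Definition c0inj i a : c0sum X := C0sum (@single_c0 i a).

Lemma c0inj_is_linear i : linear (@c0inj i).
Proof.
move=> k a b; apply: c0sumP => j /=; case: (pselect (i = j)) => [<-|ij].
  by rewrite [RHS]/(k *: single a i + single b i) !single_id.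
rewrite [RHS]/(k *: single a j + single b j).
by rewrite !single_neq// scaler0; exact/esym/addr0.
Qed.

HB.instance Definition _ i :=
  GRing.isLinear.Build K (X i) (c0sum X) _ (@c0inj i) (@c0inj_is_linear i).

Definition c0proj i (x : c0sum X) : X i := x i.

Lemma c0proj_is_linear i : linear (@c0proj i).
Proof. by []. Qed.

HB.instance Definition _ i :=
  GRing.isLinear.Build K (c0sum X) (X i) _ (@c0proj i) (@c0proj_is_linear i).

Lemma norm_c0proj i x : `|c0proj i x| <= `|x|.
Proof. exact: c0norm_ge. Qed.

Lemma norm_c0inj i a : `|@c0inj i a| = `|a|.
Proof.
apply/eqP; rewrite eq_le; apply/andP; split; last first.
  by rewrite -[X in `|X| <= _](single_id a); exact: (c0norm_ge (c0inj a) i).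
apply: c0norm_le => //= j; case: (pselect (i = j)) => [<-|ij].
  by rewrite single_id.
by rewrite single_neq// normr0.
Qed.

Lemma c0proj_continuous i : continuous (@c0proj i).
Proof. by apply: nonexpansive_continuous; exact: norm_c0proj. Qed.

Lemma c0inj_continuous i : continuous (@c0inj i).
Proof. by apply: nonexpansive_continuous => a; rewrite norm_c0inj. Qed.

(** [{classic I}] supplies the equality test behind list membership. A repeated index would count
    its coordinate several times, hence [uniq s] below. *)
Definition c0restrict (s : seq {classic I}) (y : forall i, X i) : c0sum X :=
  \sum_(i <- s) c0inj (y i).

Lemma c0restrictE s y i : uniq s ->
  c0restrict s y i = if (i : {classic I}) \in s then y i else 0.
Proof.
rewrite /c0restrict; elim: s => [|j s IHs] /=; first by rewrite big_nil.
move=> /andP[js us]; rewrite big_cons inE.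
rewrite -[LHS]/(single (y j) i + (\sum_(i <- s) c0inj (y i)) i).
rewrite IHs//; case: eqVneq => [->|/eqP ij] /=.
  by rewrite single_id (negbTE js) addr0.
by rewrite single_neq ?add0r//; exact/nesym.
Qed.

End Coordinates.

(** * Norms of functionals, for an abstract real part *)

Section RealPart.
Variables (K : numFieldType) (re : K -> K).
(* What the argument uses of [idfun] on R and of ['Re] on R[i]. *)
Hypothesis reD : {morph re : x y / x + y}.
Hypothesis re_le : forall x, re x <= `|x|.
Hypothesis re_rot : forall x, exists2 t, `|t| = 1 & re (t * x) = `|x|.
Hypothesis lubK : forall A : set K, A !=set0 ->
  A `<=` [set x | x \is Num.real] -> ubound A !=set0 -> supremums A !=set0.

Lemma re0 : re 0 = 0.
Proof. by apply: (addrI (re 0)); rewrite -reD !addr0. Qed.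

Lemma reN x : re (- x) = - re x.
Proof. by apply: (addrI (re x)); rewrite -reD !subrr re0. Qed.

Lemma reB x y : re (x - y) = re x - re y.
Proof. by rewrite reD reN. Qed.

Section DualNorm.
Variables (X : normedModType K) (f : dual X).

(** [supremum] is meaningful only where a least upper bound exists; continuity bounds the set by
    [d^-1], and [lubK] then provides one. *)
Lemma dual_norm_lub :
  supremums [set `|f c| | c in @unit_ball K X] (dual_norm f).
Proof.
have A0 : [set `|f c| | c in @unit_ball K X] !=set0.
  by exists `|f 0|; exists 0 => //; rewrite /unit_ball/= normr0.
rewrite /dual_norm /supremum ifF; last by apply/negbTE/set0P.
apply: xgetPex; apply: lubK => //.
  by move=> _ [c _ <-] /=; exact: normr_real.
have [d d0 fd] := dual_small_near0 f ltr01; exists d^-1 => _ [c /= c1 <-].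
have := fd (d *: c); rewrite linearZ /= !normrZ gtr0_norm// => fdc.
rewrite -[leRHS]mulr1 ler_pdivlMl//; apply: fdc.
by rewrite ler_piMr// ltW.
Qed.

Lemma dual_norm_ge c : `|c| <= 1 -> `|f c| <= dual_norm f.
Proof. by move=> c1; apply: dual_norm_lub.1; exists c. Qed.

Lemma dual_norm_le M : (forall c, `|c| <= 1 -> `|f c| <= M) -> dual_norm f <= M.
Proof. by move=> fM; apply: dual_norm_lub.2 => _ [c c1 <-]; exact: fM. Qed.

Lemma re_dual_norm c : `|c| <= 1 -> re (f c) <= dual_norm f.
Proof. by move=> c1; rewrite (le_trans (re_le _))// dual_norm_ge. Qed.

(** A unimodular factor on [c] turns the modulus of [f c] into a real part; if no such [c] existed,
    [dual_norm f - e] would bound all moduli. *)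
Lemma dual_norm_approx e : 0 < e ->
  exists2 c, `|c| <= 1 & dual_norm f - e < re (f c).
Proof.
move=> e0; apply: contrapT => fe.
suff : dual_norm f <= dual_norm f - e
  by rewrite lerBrDr gerDl => /(lt_le_trans e0); rewrite ltxx.
(* The order of [K] may be partial, so the case split below needs real elements. *)
have nR : dual_norm f \is Num.real.
  by rewrite ger0_real// (le_trans _ (dual_norm_ge _ (c := 0)))// ?normr0.
apply: dual_norm_le => c c1.
case: (real_leP (normr_real (f c)) (rpredB nR (gtr0_real e0))) => // fc.
exfalso; apply: fe; have [t t1 tc] := re_rot (f c).
exists (t *: c); first by rewrite normrZ t1 mul1r.
by rewrite linearZ /= tc.
Qed.

End DualNorm.

(* P1 is the case where [cl] is the identity, closed P1 the one where it is
   the norm closure. *)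
Definition weak_interior (cl : forall V : normedModType K, set V -> set V)
    (V : normedModType K) : Prop :=
  forall C : set V, is_convex_comb_slices re C -> forall x, C x ->
  exists W, [/\ rel_weakly_open W, W x & W `<=` cl V C].

(** * Convex combinations of slices of the sum and of its summands *)

Section C0.
Variables (I : Type) (X : I -> completeNormedModType K).
Local Notation Z := (c0sum X).

Lemma norm_c0_le (z : Z) M : 0 <= M -> (forall i, `|z i| <= M) -> `|z| <= M.
Proof. exact: c0norm_le. Qed.

Lemma c0sumBE (x y : Z) i : (x - y) i = x i - y i.
Proof. by []. Qed.

Lemma c0sumDE (x y : Z) i : (x + y) i = x i + y i.
Proof. by []. Qed.

(* Since [z] and the finitely supported [v] have disjoint supports, [v - z] stays
   in the unit ball. *)
Lemma dual_tail_small (F : dual Z) (e : K) : 0 < e ->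
  exists s : seq {classic I}, forall z : Z, `|z| <= 1 ->
    (forall i : {classic I}, i \in s -> z i = 0) -> - e <= re (F z).
Proof.
move=> e0; have e20 : 0 < e / 2 by rewrite divr_gt0.
have [u u1 Fu] := dual_norm_approx F e20.
have [d d0 Fd] := dual_small_near0 F e20.
(* [s] lists the coordinates where [u] has norm at least [d]; erasing the others moves [u] by at
   most [d], hence [F u] by at most [e / 2]. *)
have /(@finite_seqP {classic I})[s0 sE] := c0funP u d0.
pose s := undup s0.
have us : uniq s by exact: undup_uniq.
have sP (i : {classic I}) : i \in s = (d <= `|u i|).
  have E : [set` s0] i <-> d <= `|u i| by rewrite -sE.
  by rewrite mem_undup; apply/idP/idP => /E.
exists s => z z1 zs.
pose v := c0restrict s u.
have uv : `|F (u - v)| <= e / 2.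
  apply/Fd/norm_c0_le => [|i]; first exact: ltW.
  rewrite c0sumBE c0restrictE// sP; case: ifPn => [_|].
    by rewrite subrr normr0 ltW.
  rewrite subr0 => nd.
  case: (real_leP (normr_real (u i)) (gtr0_real d0)) => // /ltW.
  by rewrite (negbTE nd).
have vz : `|v - z| <= 1.
  apply: norm_c0_le => // i; rewrite c0sumBE c0restrictE//.
  case: ifPn => [/zs ->|_].
    by rewrite subr0 (le_trans _ u1)//; exact: c0norm_ge.
  by rewrite sub0r normrN (le_trans _ z1)//; exact: c0norm_ge.
have Fv : dual_norm F - e <= re (F v).
  rewrite -(subKr u v) linearB/= reB [X in _ - X]splitr opprD addrA.
  by apply: lerB; [exact: ltW|apply: le_trans uv].
have := re_dual_norm F vz; rewrite linearB/= reB lerBlDr => Fvz.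
by have := le_trans Fv Fvz; rewrite lerD2l.
Qed.

(* The freedom in [s] lets all slices of a convex combination share the same [s];
   [d] then depends on its size. *)
Lemma slice_finite_coords (F : dual Z) (e : K) (z : Z) : `|z| <= 1 ->
  dual_norm F - e < re (F z) ->
  exists s0 : seq {classic I}, forall s : seq {classic I}, uniq s ->
    {subset s0 <= s} -> exists2 d : K, 0 < d & forall w : Z, `|w| <= 1 ->
      (forall i : {classic I}, i \in s ->
         re (F (c0inj (z i))) - d < re (F (c0inj (w i)))) ->
      dual_norm F - e < re (F w).
Proof.
move=> z1; rewrite -subr_gt0; set h := (X in 0 < X) => h0.
(* The tails of [w] and [z] and the total loss on [s] each cost at most [q]; the fourth quarter
   keeps the inequality strict. *)
have [q q0 hq] : exists2 q : K, 0 < q & h = q + q + (q + q).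
  by exists (h / 2 / 2); [rewrite !divr_gt0|rewrite -!splitr].
have [s0 s0P] := dual_tail_small F q0; exists s0 => s us s0s.
(* The successor keeps [n] positive when [s] is empty. *)
pose n := (size s).+1%:R : K.
have n0 : (0 : K) < n by rewrite ltr0n.
exists (q / n) => [|w w1 zw]; first by rewrite divr_gt0.
have tailP (x : Z) : `|x| <= 1 -> `|x - c0restrict s x| <= 1.
  move=> x1; apply: norm_c0_le => // i; rewrite c0sumBE c0restrictE//.
  case: ifPn => _; first by rewrite subrr normr0.
  by rewrite subr0 (le_trans _ x1)//; exact: c0norm_ge.
have tail0 (x : Z) (i : {classic I}) : i \in s0 -> (x - c0restrict s x) i = 0.
  by move=> /s0s is_; rewrite c0sumBE c0restrictE// is_ subrr.
have Fw := s0P _ (tailP _ w1) (tail0 w).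
(* The tail bound is one-sided; negating the tail of [z] yields an upper bound. *)
have Fz : - q <= re (F (- (z - c0restrict s z))).
  apply: s0P => [|i /(tail0 z) zi]; first by rewrite normrN tailP.
  by rewrite -[LHS]/(- ((z - c0restrict s z) i)) zi oppr0.
have Fp : re (F (c0restrict s z)) - q <= re (F (c0restrict s w)).
  have FpE (x : Z) : re (F (c0restrict s x)) =
      \sum_(i <- s) re (F (c0inj (x i))).
    by rewrite /c0restrict linear_sum (big_morph re reD re0).
  rewrite !FpE.
  apply: (@le_trans _ _ (\sum_(i <- s) (re (F (c0inj (z i))) - q / n))).
    rewrite big_split/= lerD2l sumrN lerN2.
    rewrite big_const_seq count_predT iter_addr addr0.
    rewrite -mulr_natr -mulrA ler_piMr ?(ltW q0)// mulrC ler_pdivrMr// mul1r.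
    by rewrite ler_nat.
  by rewrite big_seq [leRHS]big_seq; apply: ler_sum => i /zw /ltW.
have Fw' : re (F (w - c0restrict s w)) = re (F w) - re (F (c0restrict s w)).
  by rewrite linearB/= reB.
have Fz' : re (F (- (z - c0restrict s z))) = re (F (c0restrict s z)) - re (F z).
  by rewrite linearN linearB/= opprB reB.
rewrite {}Fw' lerBrDr in Fw; rewrite {}Fz' lerBrDr in Fz.
have {}Fw := le_trans (lerD (lexx (- q)) Fp) Fw.
have {}Fw := le_trans (lerD (lexx (- q)) (lerD Fz (lexx (- q)))) Fw.
rewrite /h in hq.
have -> : dual_norm F - e = re (F z) - (q + q + (q + q)).
  by rewrite -hq opprB addrCA subrr addr0.
apply: lt_le_trans Fw; rewrite -subr_gt0.
rewrite (_ : _ - _ = q)//.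
have : forall x y : K, - x + (- x + y - x) - (y - (x + x + (x + x))) = x.
  by move=> x y; ring.
exact.
Qed.

Definition box_sub (s : seq {classic I}) (D : forall i, set (X i))
    (C : set Z) : Prop :=
  forall w : Z, `|w| <= 1 ->
    (forall i : {classic I}, i \in s -> D i (w i)) -> C w.

Lemma convex_comb_sub_ball (V : normedModType K) (C : set V) :
  is_convex_comb_slices re C -> C `<=` @unit_ball K V.
Proof.
move=> [n [l [S [l0 l1 sS ->]]]] _ [x Sx <-].
rewrite /unit_ball/= -l1 (le_trans (ler_norm_sum _ _ _))// ler_sum// => k _.
have [f [e [_ _ SE]]] := sS k; have := Sx k; rewrite SE => -[x1 _].
by rewrite normrZ gtr0_norm// ler_piMr// ltW.
Qed.

(** Each [D i] combines, with the weights of [C], slices cut by the restrictions of the [F k] to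
    [X i] just below their values at the coordinates of the [zz k]. A point [w] of the box is
    decomposed along [D i] on [s]; elsewhere every term copies [w], as the weights sum to 1. *)
Lemma convex_comb_coords (C : set Z) (z : Z) :
  is_convex_comb_slices re C -> C z ->
  exists (s : seq {classic I}) (D : forall i, set (X i)),
    [/\ uniq s, forall i, is_convex_comb_slices re (D i) /\ D i (z i) &
        box_sub s D C].
Proof.
move=> [n [l [S [l0 l1 sS ->]]]] [zz /= Szz zE].
have [F FP] := choice sS; have {FP}[e eP] := choice FP.
have zz1 k : `|zz k| <= 1.
  by have [_ _ SE] := eP k; have := Szz k; rewrite SE => -[].
have Fzz k : dual_norm (F k) - e k < re (F k (zz k)).
  by have [_ _ SE] := eP k; have := Szz k; rewrite SE => -[].
have [s0 s0P] := choice (fun k => slice_finite_coords (zz1 k) (Fzz k)).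
pose s := undup (flatten [seq s0 k | k <- enum 'I_n]).
have us : uniq s by exact: undup_uniq.
have s0s k : {subset s0 k <= s}.
  move=> i ik; rewrite mem_undup; apply/flattenP; exists (s0 k) => //.
  by apply/mapP; exists k; rewrite ?mem_enum.
have dP' k : exists d : K, 0 < d /\ forall w : Z, `|w| <= 1 ->
    (forall i : {classic I}, i \in s ->
      re (F k (c0inj (zz k i))) - d < re (F k (c0inj (w i)))) ->
    dual_norm (F k) - e k < re (F k w).
  by have [d d0 dP] := s0P k s us (@s0s k); exists d.
have {dP'}[d dP] := choice dP'.
pose f i k : dual (X i) := dual_comp (F k) (@c0inj_continuous K I X i).
(* This width puts the threshold of the slice at [re (f i k (zz k i)) - d k]. *)
pose t i k := dual_norm (f i k) - (re (f i k (zz k i)) - d k).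
pose SS i k := slice re (f i k) (t i k).
have SSE i k a : SS i k a <->
    `|a| <= 1 /\ re (f i k (zz k i)) - d k < re (f i k a).
  by rewrite /SS /slice /t /= subKr.
pose D i := [set \sum_(k < n) l k *: x k | x in
  [set x : 'I_n -> X i | forall k, SS i k (x k)]].
have zzi1 k i : `|zz k i| <= 1.
  by rewrite (le_trans _ (zz1 k))//; exact: c0norm_ge.
have subd (x y : K) : 0 < y -> x - y < x by move=> y0; rewrite gtrDl oppr_lt0.
exists s, D; split => //.
  move=> i; split.
    exists n, l, (SS i); split => // k; exists (f i k), (t i k); split => //.
      apply: dual_norm_le => a a1; have [F1 _ _] := eP k.
      apply: le_trans F1; rewrite /=; apply: dual_norm_ge.
      by rewrite norm_c0inj.
    rewrite /t subr_gt0; apply: lt_le_trans (re_dual_norm (f i k) (zzi1 k i)).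
    by apply: subd; have [] := dP k.
  exists (fun k => zz k i).
    move=> k; apply/SSE; split; first exact: zzi1.
    by apply: subd; have [] := dP k.
  rewrite -zE -[RHS]/(c0proj i _) linear_sum.
  by apply: eq_bigr => k _; rewrite linearZ.
move=> w w1 Dw.
(* Membership sits inside the existential so that one choice serves all [i]; the filler 0 off [s] is
   erased by [c0restrict]. *)
have exx i : exists x : 'I_n -> X i, (i : {classic I}) \in s ->
    (forall k, SS i k (x k)) /\ \sum_(k < n) l k *: x k = w i.
  case: (boolP ((i : {classic I}) \in s)) => [is_|_]; last by exists (fun=> 0).
  by have [x xS xE] := Dw i is_; exists x.
pose x i := projT1 (cid (exx i)).
have xP i (is_ : (i : {classic I}) \in s) := projT2 (cid (exx i)) is_.
pose ww k := w + c0restrict s (fun i => x i k - w i).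
have wwE k i : ww k i = if (i : {classic I}) \in s then x i k else w i.
  rewrite c0sumDE c0restrictE//; case: ifPn => _; last exact: addr0.
  by rewrite addrC subrK.
have ww1 k : `|ww k| <= 1.
  apply: norm_c0_le => // i; rewrite wwE; case: ifPn => [/xP[/(_ k)/SSE[]]//|_].
  by rewrite (le_trans _ w1)//; exact: c0norm_ge.
exists ww => [k /=|].
  have [_ _ ->] := eP k; split; first exact: ww1.
  apply: (dP k).2 => [|i is_]; [exact: ww1|rewrite wwE is_].
  by have [/(_ k)/SSE[]] := xP i is_.
apply: c0sumP => i.
rewrite -[LHS]/(c0proj i _) linear_sum.
transitivity (\sum_(k < n)
    l k *: (if (i : {classic I}) \in s then x i k else w i)).
  by apply: eq_bigr => k _; rewrite linearZ /= -wwE.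
case: (boolP ((i : {classic I}) \in s)) => [is_|_].
  by have [] := xP i is_.
by rewrite -scaler_suml l1 scale1r.
Qed.

(** The projection maps the unit ball onto the unit ball, so composing with it preserves the norm of
    a functional and the width of its slices. *)
Lemma convex_comb_lift (i : I) (D : set (X i)) (a : X i) :
  is_convex_comb_slices re D -> D a ->
  exists C : set Z, [/\ is_convex_comb_slices re C, C (c0inj a) &
    forall w : Z, C w -> D (w i)].
Proof.
move=> [n [l [S [l0 l1 sS ->]]]] [x /= Sx xE].
have [f fP] := choice sS; have {fP}[e eP] := choice fP.
pose F k : dual Z := dual_comp (f k) (@c0proj_continuous K I X i).
have FE k : dual_norm (F k) = dual_norm (f k).
  rewrite /dual_norm; congr supremum; apply/seteqP; split => _ [c /= c1 <-].
    exists (c i) => //; rewrite /unit_ball/= (le_trans _ c1)//.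
    exact: c0norm_ge.
  exists (c0inj c); first by rewrite /unit_ball/= norm_c0inj.
  by rewrite /= /c0proj /= single_id.
pose SS k := slice re (F k) (e k).
exists [set \sum_(k < n) l k *: x k | x in
  [set x : 'I_n -> Z | forall k, SS k (x k)]].
split.
- exists n, l, SS; split => // k; exists (F k), (e k).
  by have [? ? _] := eP k; rewrite FE.
- exists (fun k => c0inj (x k)).
    move=> k; have [_ _ SE] := eP k; have := Sx k; rewrite SE => -[x1 xS].
    split; first by rewrite /unit_ball/= norm_c0inj.
    by rewrite FE /= /c0proj /= single_id.
  by rewrite -xE linear_sum; apply: eq_bigr => k _; rewrite linearZ.
- move=> _ [y Sy <-]; exists (fun k => y k i).
    move=> k /=; have [_ _ ->] := eP k; have [y1] := Sy k.
    rewrite FE; split => //.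
    by rewrite /unit_ball/= (le_trans _ y1)//; exact: c0norm_ge.
  rewrite -[RHS]/(c0proj i _) linear_sum.
  by apply: eq_bigr => k _; rewrite linearZ.
Qed.

(** Both properties at once: compatibility of [cl] with projections serves the passage to the
    summands, compatibility with boxes the converse. *)
Lemma c0sum_weak_interior (cl : forall V : normedModType K, set V -> set V) :
  (forall i (C : set Z) (D : set (X i)), (forall w, C w -> D (w i)) ->
     forall w, cl Z C w -> cl (X i) D (w i)) ->
  (forall (s : seq {classic I}) (D : forall i, set (X i)) (C : set Z), uniq s ->
     (forall i, D i `<=` @unit_ball K (X i)) -> box_sub s D C ->
     box_sub s (fun i => cl (X i) (D i)) (cl Z C)) ->
  weak_interior cl Z <-> forall i, weak_interior cl (X i).
Proof.
move=> cl_proj cl_box; split=> [P i D ccD a Da|P C ccC z Cz].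
  have [C [ccC Ca CD]] := convex_comb_lift ccD Da.
  have [_ [[U [oU ->]] [Ua a1] UC]] := P _ ccC _ Ca.
  exists (c0inj (X:=X) (i:=i) @^-1` U `&` @unit_ball K (X i)); split.
  - exists (c0inj (X:=X) (i:=i) @^-1` U); split => //.
    exact: weakly_open_preimage (@c0inj_continuous _ _ _ i) oU.
  - by split => //; rewrite /unit_ball/= -norm_c0inj.
  - move=> b [Ub b1]; have := cl_proj i C D CD (c0inj b).
    rewrite /= single_id; apply.
    by apply: UC; split => //; rewrite /unit_ball/= norm_c0inj.
have [s [D [us DP DC]]] := convex_comb_coords ccC Cz.
have exU i : exists U : set (X i), [/\ weakly_open U, U (z i) &
    U `&` @unit_ball K (X i) `<=` cl (X i) (D i)].
  by have [_ [[U [oU ->]] [Uz z1] UD]] := P i _ (DP i).1 _ (DP i).2; exists U.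
pose U i := projT1 (cid (exU i)).
have UP i : [/\ weakly_open (U i), U i (z i) &
    U i `&` @unit_ball K (X i) `<=` cl (X i) (D i)].
  exact: projT2 (cid (exU i)).
(* Finiteness of [s] makes this intersection weakly open. *)
pose V := \bigcap_(i in [set` s]) (@c0proj K I X i @^-1` U i).
have oV : weakly_open V.
  apply: weakly_open_bigcap => i _; have [oU _ _] := UP i.
  exact: weakly_open_preimage (@c0proj_continuous _ _ _ i) oU.
exists (V `&` @unit_ball K Z); split; first by exists V.
  split; first by move=> i _; have [] := UP i.
  by have [] := convex_comb_sub_ball ccC Cz.
have {}DC := cl_box s D C us (fun i => convex_comb_sub_ball (DP i).1) DC.
move=> w [Vw w1]; apply: DC => // i is_; have [_ _] := UP i; apply.
split; first exact: Vw.
by rewrite /unit_ball/= (le_trans _ w1)//; exact: c0norm_ge.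
Qed.

Lemma c0sum_P1 : property_P1 Z re <-> forall i, property_P1 (X i) re.
Proof.
apply: (c0sum_weak_interior (cl := fun V => id)) => [i C D CD w|s D C _ _ //].
exact: CD.
Qed.

(** Closures project by continuity. For boxes, [w] is corrected on [s] by nearby points of the
    [D i]; the sup norm keeps the result close to [w] and in the unit ball. *)
Lemma c0sum_P1_closure :
  property_P1_closure Z re <-> forall i, property_P1_closure (X i) re.
Proof.
apply: (c0sum_weak_interior (cl := fun V => closure)).
  move=> i C D CD w Cw B Bw.
  have [v [Cv Bv]] := Cw _ (@c0proj_continuous K I X i w B Bw).
  by exists (v i); split; [exact: CD|].
move=> s D C us D1 DC w w1 Dw B /nbhs_normP[e /= e0 eB].
(* Coordinate bounds reach the norm only as a weak inequality, while the ball is open. *)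
have e20 : 0 < e / 2 by rewrite divr_gt0.
have exy i : exists y : X i, (i : {classic I}) \in s ->
    D i y /\ `|w i - y| <= e / 2.
  case: (boolP ((i : {classic I}) \in s)) => [is_|_]; last by exists 0.
  have [|y [Dy yw]] := Dw i is_ [set y | `|w i - y| <= e / 2].
    by apply/nbhs_normP; exists (e / 2) => // y /ltW.
  by exists y.
pose y i := projT1 (cid (exy i)).
have yP i (is_ : (i : {classic I}) \in s) : D i (y i) /\ `|w i - y i| <= e / 2.
  exact: projT2 (cid (exy i)) is_.
pose v := w + c0restrict s (fun i => y i - w i).
have vE i : v i = if (i : {classic I}) \in s then y i else w i.
  rewrite c0sumDE c0restrictE//; case: ifPn => _; last exact: addr0.
  by rewrite addrC subrK.
exists v; split.
  apply: DC => [|i is_]; last by rewrite vE is_; have [] := yP i is_.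
  apply: norm_c0_le => // i; rewrite vE; case: ifPn => [/yP[/D1]//|_].
  by rewrite (le_trans _ w1)//; exact: c0norm_ge.
apply: eB; rewrite /= (@le_lt_trans _ _ (e / 2))//; last first.
  by rewrite ltr_pdivrMr// ltr_pMr// ltr1n.
apply: norm_c0_le => [|i]; first exact: ltW.
rewrite c0sumBE vE; case: ifPn => [/yP[]//|_].
by rewrite subrr normr0 ltW.
Qed.

End C0.
End RealPart.

(** * Suprema of sets of real scalars, and the two scalar fields *)

Lemma real_supremums (R : realType) (A : set R) :
  A !=set0 -> ubound A !=set0 -> supremums A !=set0.
Proof.
move=> A0 Aub; exists (sup A); split; first exact: ub_le_sup.
by move=> y; exact: ge_sup.
Qed.

Lemma complex_supremums (R : realType) (A : set R[i]) : A !=set0 ->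
  A `<=` [set x | x \is Num.real] -> ubound A !=set0 -> supremums A !=set0.
Proof.
move=> [a Aa] Ar [M AM].
have B0 : [set complex.Re x | x in A] !=set0 by exists (complex.Re a), a.
have Bub : ubound [set complex.Re x | x in A] !=set0.
  by exists (complex.Re M) => _ [x Ax <-]; have := AM x Ax;
    rewrite lecE => /andP[].
have [m [ubm lbm]] := real_supremums B0 Bub.
exists (m%:C)%C; split => [x Ax|y yub].
  by rewrite -(RRe_real (Ar _ Ax)) lecR; apply: ubm; exists x.
(* An upper bound of a real element is itself real in the order of [R[i]], so comparing real parts
   suffices. *)
have ay : a <= y by exact: yub.
have yr : y \is Num.real.
  rewrite -(subrK a y); apply: rpredD; last exact: Ar.
  by rewrite ger0_real// subr_ge0.
rewrite -(RRe_real yr) lecR; apply: lbm => _ [x Ax <-].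
by have := yub x Ax; rewrite lecE => /andP[].
Qed.

Theorem proposition2p5 (R : realType) (Gamma : Type) :
  (forall X : Gamma -> completeNormedModType R,
     (property_P1 (c0sum X) (@idfun R) <->
        forall g, property_P1 (X g) (@idfun R)) /\
     (property_P1_closure (c0sum X) (@idfun R) <->
        forall g, property_P1_closure (X g) (@idfun R))) /\
  (forall X : Gamma -> completeNormedModType R[i],
     (property_P1 (c0sum X) (fun z : R[i] => 'Re z) <->
        forall g, property_P1 (X g) (fun z : R[i] => 'Re z)) /\
     (property_P1_closure (c0sum X) (fun z : R[i] => 'Re z) <->
        forall g, property_P1_closure (X g) (fun z : R[i] => 'Re z))).
Proof.
split=> X.
  have reD : {morph @idfun R : x y / x + y} by [].
  have re_le (x : R) : idfun x <= `|x| by exact: ler_norm.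
  have re_rot (x : R) : exists2 t, `|t| = 1 & idfun (t * x) = `|x|.
    have [x0|x0] := leP 0 x; [exists 1|exists (-1)];
      rewrite ?normrN1 ?normr1 //=.
      by rewrite mul1r ger0_norm.
    by rewrite mulN1r ltr0_norm.
  have lub (A : set R) : A !=set0 -> A `<=` [set x | x \is Num.real] ->
      ubound A !=set0 -> supremums A !=set0.
    by move=> A0 _; exact: real_supremums.
  by split; [exact: c0sum_P1|exact: c0sum_P1_closure].
have reD : {morph (fun z : R[i] => 'Re z) : x y / x + y}.
  by move=> x y; rewrite raddfD.
have re_le (x : R[i]) : 'Re x <= `|x| by rewrite leif_Re_Creal.
have re_rot (x : R[i]) : exists2 t, `|t| = 1 & 'Re (t * x) = `|x|.
  have [->|x0] := eqVneq x 0.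
    by exists 1; rewrite ?normr1// mulr0 raddf0 normr0.
  exists (`|x| / x); first by rewrite normf_div normr_id divff// normr_eq0.
  by rewrite divfK//; apply/Creal_ReP; exact: normr_real.
split; [apply: c0sum_P1|apply: c0sum_P1_closure] => //.
  exact: complex_supremums.
exact: complex_supremums.
Qed.
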